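(* Let $f:\mathbb{R}^n\to\mathbb{R}$ satisfy assumptions A1 and A2 (stated in the context), and let $x^*$ be the minimizer of $f$. Then there exists $\bar{\Delta}>0$ such that, for any $\Delta$ with $0<\Delta\le\bar{\Delta}$ and any starting points $x_0,x_1\in\mathbb{R}^n$ with $x_0\ne x_1$, the sequence $\{x_k\}$ generated by the BBstab algorithm with parameter $\Delta$ converges to $x^*$ with R-linear rate.
   Context: $\|\cdot\|$ is the Euclidean vector norm and the induced matrix norm; $g(x)=\nabla f(x)$, $g_k=g(x_k)$; $B_\rho(x^* )=\{x\in\mathbb{R}^n:\|x-x^*\|\le\rho\}$. Assumption A1: $f$ is twice continuously differentiable, and there are constants $0<\Lambda_1\le\Lambda_2$ such that $\Lambda_1\|v\|^2\le v^T\nabla^2 f(x)v\le\Lambda_2\|v\|^2$ for all $x,v\in\mathbb{R}^n$. (So $f$ has a unique minimizer $x^*$.) Assumption A2: there exist $\rho>0$ and $L\ge 0$ such that $\|\nabla^2 f(x)-\nabla^2 f(x^* )\|\le L\|x-x^*\|$ for all $x\in B_\rho(x^* )$. BBstab algorithm with parameter $\Delta>0$: given $x_0\neq x_1$ in $\mathbb{R}^n$, for $k=1,2,\ldots$: if $g_k=0$, stop; otherwise set $s_{k-1}=x_k-x_{k-1}$, $y_{k-1}=g_k-g_{k-1}$, $\alpha_k=\min\{\alpha_k^{BB},\alpha_k^{stab}\}$ with $\alpha_k^{stab}=\Delta/\|g_k\|$, and $x_{k+1}=x_k-\alpha_k g_k$. Here $\alpha_k^{BB}$ is one of the two choices $\alpha_k^{BB1}=\frac{s_{k-1}^Ts_{k-1}}{s_{k-1}^Ty_{k-1}}$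 or $\alpha_k^{BB2}=\frac{s_{k-1}^Ty_{k-1}}{y_{k-1}^Ty_{k-1}}$, fixed for the whole run; the result is asserted for each of the two choices. If the algorithm stops at iteration $k$ (so $x_k=x^*$), we set $x_j=x_k$ for all $j\ge k$. R-linear rate means: there exist $\gamma>0$ and $c\in(0,1)$ such that $\|x_{k+1}-x^*\|\le\gamma c^k\|x_1-x^*\|$ for all $k\ge 1$. *)

(* Defs.v *)
From HB Require Import structures.
From mathcomp Require Import all_boot all_order all_algebra.
From mathcomp Require Import all_classical all_reals all_analysis.

Set Implicit Arguments.
Unset Strict Implicit.
Unset Printing Implicit Defensive.

Import Order.TTheory GRing.Theory Num.Theory.
Import numFieldNormedType.Exports.

Local Open Scope classical_set_scope.
Local Open Scope ring_scope.

(* Vectors of R^n are row vectors and matrices act on them from the right, as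
   in the library's jacobian ('J f p). The library norm `|_| on matrices is the
   max norm; it induces the same topology as the Euclidean norm, and is used
   only through that topology (differentiability, continuity, limits). *)

Definition dot (R : realType) (n : nat) (u v : 'rV[R]_n) : R :=
  \sum_i u 0 i * v 0 i.

Definition enorm (R : realType) (n : nat) (u : 'rV[R]_n) : R :=
  Num.sqrt (dot u u).

(* Taking the sup over the unit ball rather than the unit sphere only matters
   for n = 0, where the sphere is empty. *)
Definition opnorm (R : realType) (n : nat) (A : 'M[R]_n) : R :=
  sup [set enorm (v *m A) | v in [set v : 'rV[R]_n | enorm v <= 1]].

Definition grad (R : realType) (n : nat) (f : 'rV[R]_n -> R) (x : 'rV[R]_n) :
    'rV[R]_n :=
  \row_j 'D_(delta_mx 0 j) f x.

(* Entry (i, j) is the i-th partial derivative of the j-th component of the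
   gradient. *)
Definition hess (R : realType) (n : nat) (f : 'rV[R]_n -> R) (x : 'rV[R]_n) :
    'M[R]_n :=
  'J (grad f) x.

Definition twice_continuously_differentiable (R : realType) (n : nat)
    (f : 'rV[R]_n -> R) : Prop :=
  [/\ forall x, differentiable f x,
      forall x, differentiable (grad f) x &
      continuous (hess f)].

Definition assumption_A1 (R : realType) (n : nat) (f : 'rV[R]_n -> R) : Prop :=
  twice_continuously_differentiable f /\
  exists L1 L2 : R,
    [/\ 0 < L1, L1 <= L2 &
        forall x v : 'rV[R]_n,
          L1 * enorm v ^+ 2 <= dot (v *m hess f x) v <= L2 * enorm v ^+ 2].

Definition assumption_A2 (R : realType) (n : nat) (f : 'rV[R]_n -> R)
    (xs : 'rV[R]_n) : Prop :=
  exists rho L : R,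
    [/\ 0 < rho, 0 <= L &
        forall x : 'rV[R]_n, enorm (x - xs) <= rho ->
          opnorm (hess f x - hess f xs) <= L * enorm (x - xs)].

Definition minimizer (R : realType) (n : nat) (f : 'rV[R]_n -> R)
    (xs : 'rV[R]_n) : Prop :=
  forall x, f xs <= f x.

Inductive BB_choice := BB1 | BB2.

Definition BB_stepsize (R : realType) (n : nat) (b : BB_choice)
    (s y : 'rV[R]_n) : R :=
  match b with
  | BB1 => dot s s / dot s y
  | BB2 => dot s y / dot y y
  end.

(* x_{k+1} from xp = x_{k-1} and xc = x_k. After the algorithm stops, the
   sequence is continued by a constant. *)
Definition BBstab_next (R : realType) (n : nat) (b : BB_choice)
    (f : 'rV[R]_n -> R) (Delta : R) (xp xc : 'rV[R]_n) : 'rV[R]_n :=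
  if grad f xc == 0 then xc else
  let s := xc - xp in
  let y := grad f xc - grad f xp in
  let alpha := Num.min (BB_stepsize b s y) (Delta / enorm (grad f xc)) in
  xc - alpha *: grad f xc.

Definition BBstab (R : realType) (n : nat) (b : BB_choice)
    (f : 'rV[R]_n -> R) (Delta : R) (x0 x1 : 'rV[R]_n) (k : nat) : 'rV[R]_n :=
  (iter k (fun p => (p.2, BBstab_next b f Delta p.1 p.2)) (x0, x1)).1.

Definition R_linear_rate (R : realType) (n : nat) (x : nat -> 'rV[R]_n)
    (xs : 'rV[R]_n) : Prop :=
  exists gamma c : R,
    [/\ 0 < gamma, 0 < c < 1 &
        forall k : nat, (1 <= k)%N ->
          enorm (x k.+1 - xs) <= gamma * c ^+ k * enorm (x 1%N - xs)].

(* Main.v *)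
Require Import Defs.
From HB Require Import structures.
From mathcomp Require Import all_boot all_order all_algebra.
From mathcomp Require Import all_classical all_reals all_analysis.
From mathcomp Require Import ring lra complex.
Import Order.TTheory GRing.Theory Num.Theory.
Import numFieldNormedType.Exports.
Local Open Scope classical_set_scope.
Local Open Scope ring_scope.

Set Implicit Arguments.
Unset Strict Implicit.
Unset Printing Implicit Defensive.

(** The gradient [g] is strongly monotone and Lipschitz with constants [mu] and
    [l], so both Barzilai-Borwein step sizes lie between [mu / l ^+ 2] and
    [mu^-1]. As long as the gradient is large compared with [Delta], the
    stabilized step is therefore the short step [Delta / enorm g], which lowers
    the squared distance to the minimizer by at least [Delta ^+ 2]
    ([far_decrease]). Hence the iterates reach, and never leave again, a ball
    whose radius is a fixed multiple of [Delta]
    ([eventually_within_rad]); there the step sizes are bounded below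
    independently of [Delta], and by the Lipschitz condition on the Hessian the
    gradient is linear up to a relative error proportional to [Delta].

    It remains to contract a small perturbation of the Barzilai-Borwein
    iteration for a quadratic with Hessian [H] ([local_contraction]). Split the
    error along eigenvectors of [H]. The inverse of a step is, up to the
    perturbation, at least a Rayleigh quotient of [H] along the previous
    gradient. If all coordinates with eigenvalue below [lam i] are already
    small while the coordinate [i] is not, this Rayleigh quotient is nearly
    [lam i] or more, so the next step contracts the coordinate [i]
    ([coord_decay_step]). A coordinate therefore decays until it is small, and
    the two steps that may follow before control is regained cannot make it
    large again ([delayed_decay]). By induction on the eigenvalues all coordinates become
    small after a number [m] of steps that depends only on [H] and on the
    bounds on the step sizes ([coords_decay]). For small [Delta] the
    perturbations accumulated during [m] steps are harmless, so every block of
    [m] steps halves the error, which is R-linear convergence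
    ([geometric_of_block_halving]).

    The argument needs the Hessian at the minimizer to be diagonalizable, that
    is, symmetric; this is Schwarz's theorem ([hess_sym]). *)

(** * Euclidean inner product and norm *)

Section InnerProduct.
Context {R : realType} {n : nat}.
Implicit Types (u v w : 'rV[R]_n) (a : R).

Lemma dotE u v : dot u v = (u *m v^T) 0 0.
Proof. by rewrite mxE; apply: eq_bigr => i _; rewrite mxE. Qed.

Lemma dotC u v : dot u v = dot v u.
Proof. by apply: eq_bigr => i _; rewrite mulrC. Qed.

Lemma dotDl u v w : dot (u + v) w = dot u w + dot v w.
Proof. by rewrite !dotE mulmxDl mxE. Qed.

Lemma dotDr u v w : dot w (u + v) = dot w u + dot w v.
Proof. by rewrite dotC dotDl !(dotC w). Qed.

Lemma dotZl a u v : dot (a *: u) v = a * dot u v.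
Proof. by rewrite !dotE -scalemxAl mxE. Qed.

Lemma dotZr a u v : dot u (a *: v) = a * dot u v.
Proof. by rewrite dotC dotZl dotC. Qed.

Lemma dotNl u v : dot (- u) v = - dot u v.
Proof. by rewrite -scaleN1r dotZl mulN1r. Qed.

Lemma dotNr u v : dot u (- v) = - dot u v.
Proof. by rewrite dotC dotNl dotC. Qed.

Lemma dotBl u v w : dot (u - v) w = dot u w - dot v w.
Proof. by rewrite dotDl dotNl. Qed.

Lemma dotBr u v w : dot w (u - v) = dot w u - dot w v.
Proof. by rewrite dotDr dotNr. Qed.

Lemma dot0l u : dot 0 u = 0.
Proof. by rewrite -(scale0r 0) dotZl mul0r. Qed.

Lemma dot0r u : dot u 0 = 0.
Proof. by rewrite dotC dot0l. Qed.

Definition dot_lin :=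
  (dotDl, dotDr, dotZl, dotZr, dotNl, dotNr).

Lemma dot_ge0 u : 0 <= dot u u.
Proof. by apply: sumr_ge0 => i _; rewrite -expr2 sqr_ge0. Qed.

Lemma dot_eq0 u : (dot u u == 0) = (u == 0).
Proof.
apply/idP/eqP => [|->]; last by rewrite dot0l.
rewrite psumr_eq0 => [/allP h|i _]; last by rewrite -expr2 sqr_ge0.
apply/rowP => i; rewrite mxE; apply/eqP.
by have /= := h i (mem_index_enum _); rewrite -expr2 sqrf_eq0.
Qed.

Lemma enorm_ge0 u : 0 <= enorm u.
Proof. exact: sqrtr_ge0. Qed.

Lemma sqr_enorm u : enorm u ^+ 2 = dot u u.
Proof. by rewrite sqr_sqrtr // dot_ge0. Qed.

Lemma enorm_eq0 u : (enorm u == 0) = (u == 0).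
Proof. by rewrite -dot_eq0 -sqr_enorm sqrf_eq0. Qed.

Lemma enorm_gt0 u : (0 < enorm u) = (u != 0).
Proof. by rewrite lt_def enorm_ge0 andbT enorm_eq0. Qed.

Lemma enorm0 : enorm (0 : 'rV[R]_n) = 0.
Proof. by apply/eqP; rewrite enorm_eq0. Qed.

Lemma enormZ a u : enorm (a *: u) = `|a| * enorm u.
Proof.
by rewrite /enorm dotZl dotZr mulrA -expr2 sqrtrM ?sqr_ge0 // sqrtr_sqr.
Qed.

Lemma enormN u : enorm (- u) = enorm u.
Proof. by rewrite -scaleN1r enormZ normrN1 mul1r. Qed.

Lemma sqr_enormD u v :
  enorm (u + v) ^+ 2 = enorm u ^+ 2 + 2 * dot u v + enorm v ^+ 2.
Proof. by rewrite !sqr_enorm !dot_lin (dotC v u); ring. Qed.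

Lemma dot_le_enorm u v : dot u v <= enorm u * enorm v.
Proof.
have [->|u0] := eqVneq u 0; first by rewrite dot0l enorm0 mul0r.
have [->|v0] := eqVneq v 0; first by rewrite dot0r enorm0 mulr0.
have pu : 0 < enorm u by rewrite enorm_gt0.
have pv : 0 < enorm v by rewrite enorm_gt0.
have := sqr_ge0 (enorm (enorm v *: u - enorm u *: v)).
rewrite sqr_enormD dotNr dotZl dotZr enormN !enormZ !ger0_norm ?enorm_ge0 // => h.
have p2 : 0 < enorm u * enorm v by exact: mulr_gt0.
rewrite -(ler_pM2l p2); lra.
Qed.

Lemma normr_dot_le u v : `|dot u v| <= enorm u * enorm v.
Proof.
rewrite ler_norml dot_le_enorm andbT lerNl -dotNl -(enormN u).
exact: dot_le_enorm.
Qed.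

Lemma ler_enormD u v : enorm (u + v) <= enorm u + enorm v.
Proof.
rewrite -(@ler_pXn2r _ 2) ?nnegrE ?addr_ge0 ?enorm_ge0 //.
by rewrite sqr_enormD; have := dot_le_enorm u v; lra.
Qed.

Lemma ler_enormB u v : enorm (u - v) <= enorm u + enorm v.
Proof. by rewrite -(enormN v); exact: ler_enormD. Qed.

Lemma normr_coord_le u i : `|u 0 i| <= enorm u.
Proof.
rewrite -sqrtr_sqr ler_sqrt ?dot_ge0 // /dot (bigD1 i) //= -expr2 lerDl.
by apply: sumr_ge0 => j _; rewrite -expr2 sqr_ge0.
Qed.

Lemma dot_delta u i : dot u (delta_mx 0 i) = u 0 i.
Proof. by rewrite dotE trmx_delta -colE mxE. Qed.

Lemma ler_enorm_sum (I : finType) (F : I -> 'rV[R]_n) :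
  enorm (\sum_i F i) <= \sum_i enorm (F i).
Proof.
elim/big_ind2: _ => [|a u b v ha hb|//]; first by rewrite enorm0.
exact: le_trans (ler_enormD _ _) (lerD _ _).
Qed.

Lemma enorm_le_dot u (c : R) :
  0 <= c -> dot u u <= c * enorm u -> enorm u <= c.
Proof.
have [->|u0] := eqVneq u 0; first by rewrite enorm0.
by rewrite -sqr_enorm expr2 ler_pM2r // enorm_gt0.
Qed.

End InnerProduct.

(** * Quadratic forms and the operator norm *)

Section MatrixBounds.
Context {R : realType} {n : nat}.
Implicit Types (u v : 'rV[R]_n) (A : 'M[R]_n).

Lemma dot_mulmx_sym A u v : A^T = A -> dot (v *m A) u = dot (u *m A) v.
Proof. by move=> sA; rewrite (dotC _ v) !dotE trmx_mul sA mulmxA. Qed.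

(** The operator norm of a positive semidefinite form is its largest Rayleigh
    quotient, by polarization. *)
Lemma sym_form_le A (l : R) : A^T = A ->
  (forall v, 0 <= dot (v *m A) v <= l * enorm v ^+ 2) ->
  forall u v, dot (v *m A) u <= l * enorm v * enorm u.
Proof.
move=> sA hA u v.
have [->|u0] := eqVneq u 0; first by rewrite dot0r enorm0 mulr0.
have [->|v0] := eqVneq v 0; first by rewrite mul0mx dot0l enorm0 mulr0 mul0r.
have pu : 0 < enorm u by rewrite enorm_gt0.
have pv : 0 < enorm v by rewrite enorm_gt0.
have p2 : 0 < 4 * (enorm u * enorm v) by rewrite mulr_gt0 // mulr_gt0.
have l0 : 0 <= l.
  have /andP[h1 h2] := hA v.
  by rewrite -(@pmulr_lge0 _ (enorm v ^+ 2)) ?exprn_gt0 // (le_trans h1).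
have /andP[_ h1] := hA (enorm u *: v + enorm v *: u).
have /andP[h2 _] := hA (enorm u *: v - enorm v *: u).
have cs := dot_le_enorm v u.
have cs' : l * (2 * (enorm u * enorm v * dot v u)) <=
           l * (2 * (enorm u * enorm v * (enorm v * enorm u))).
  by rewrite ler_wpM2l // ler_pM2l // ler_pM2l // mulr_gt0.
move: h1 h2 cs'; rewrite sqr_enormD !mulmxDl mulNmx -!scalemxAl !dot_lin.
rewrite (dot_mulmx_sym v u sA) !enormZ !ger0_norm ?enorm_ge0 //.
move=> h1 h2 h3; rewrite -(ler_pM2l p2); lra.
Qed.

Lemma enorm_mulmx_le A v : enorm (v *m A) <= opnorm A * enorm v.
Proof.
have [->|v0] := eqVneq v 0; first by rewrite mul0mx enorm0 mulr0.
have pv : 0 < enorm v by rewrite enorm_gt0.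
have e1 : enorm ((enorm v)^-1 *: v) = 1.
  by rewrite enormZ ger0_norm ?invr_ge0 ?enorm_ge0 // mulVf // gt_eqF.
rewrite -ler_pdivrMr // mulrC -[X in X * _]ger0_norm ?invr_ge0 ?enorm_ge0 //.
rewrite -enormZ scalemxAl; apply: sup_upper_bound; last first.
  by exists ((enorm v)^-1 *: v) => //=; rewrite e1.
split; first by exists (enorm (0 *m A)); exists 0 => //=; rewrite enorm0.
exists (\sum_i enorm (row i A)) => _ [w /= w1 <-].
rewrite mulmx_sum_row; apply: le_trans (ler_enorm_sum _) _.
apply: ler_sum => i _; rewrite enormZ ler_piMl ?enorm_ge0 //.
exact: le_trans (normr_coord_le _ _) w1.
Qed.

End MatrixBounds.

(** * Mean value theorems for the gradient *)

Section MeanValue.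
Context {R : realType} {n : nat}.
Implicit Types (x u v : 'rV[R]_n).

Lemma differentiable_dotl (u x : 'rV[R]_n) :
  differentiable (fun w : 'rV[R]_n => dot w u) x.
Proof.
rewrite /dot.
have -> : (fun w : 'rV[R]_n => \sum_i w 0 i * u 0 i) =
   \sum_i (fun w : 'rV[R]_n => w 0 i *: (u 0 i : R)).
  by apply/funext => w; rewrite fct_sumE.
apply: differentiable_sum => i.
exact/differentiableZl/differentiable_coord.
Qed.

Lemma is_derive_line (F : 'rV[R]_n -> R) x v (t : R) :
  (forall z, differentiable F z) ->
  is_derive t 1 (fun s : R => F (x + s *: v)) ('D_v F (x + t *: v)).
Proof.
move=> dF; pose l (s : R) := x + s *: v.
have dl : is_diff t l ( *:%R ^~ v).
  have dc := is_diff_cst x t; have dv := is_diff_scalel t v.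
  by apply: (is_diff_eq (is_diffD dc dv)); rewrite add0r.
have dFl : differentiable (F \o l) t by exact: differentiable_comp.
split; first exact/derivable1_diffP.
by rewrite deriveE // diff_comp //= deriveE // diff_val scale1r.
Qed.

Lemma mean_value (F : 'rV[R]_n -> R) x v :
  (forall z, differentiable F z) ->
  exists2 t : R, 0 <= t <= 1 & F (x + v) - F x = 'D_v F (x + t *: v).
Proof.
move=> dF; pose h (s : R) := F (x + s *: v).
have dh (t : R) : is_derive t 1 h ('D_v F (x + t *: v)) by exact: is_derive_line.
have [|t t01] := @MVT_segment R h (fun t => 'D_v F (x + t *: v)) 0 1 ler01
  (fun t _ => dh t).
  apply: derivable_within_continuous => t _; exact: ex_derive.
rewrite /h scale1r scale0r addr0 subr0 mulr1 => eF.
by exists t => //; move: t01; rewrite in_itv.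
Qed.

Lemma derive_gradE (f : 'rV[R]_n -> R) x v :
  differentiable f x -> 'D_v f x = dot (grad f x) v.
Proof.
move=> df; rewrite deriveE // {1}(row_sum_delta v) linear_sum; apply: eq_bigr => i _.
by rewrite linearZ mxE deriveE // mulrC.
Qed.

Lemma derive_dotl (G : 'rV[R]_n -> 'rV[R]_n) u x v :
  differentiable G x ->
  'D_v (fun z => dot (G z) u) x = dot (v *m 'J G x) u.
Proof.
move=> dG; pose l (w : 'rV[R]_n) : R := dot w u.
have lin : linear l by move=> a w z; rewrite /l dotDl dotZl.
pose lM := GRing.isLinear.Build _ _ _ _ _ lin.
pose L : {linear 'rV[R]_n -> R} := HB.pack l lM.
have dl z : differentiable L z by exact: differentiable_dotl.
have dc : continuous L by move=> z; exact: differentiable_continuous.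
rewrite (_ : (fun z => _) = L \o G) // deriveE; last exact: differentiable_comp.
by rewrite diff_comp // diff_lin //= -deriveE // deriveEjacobian.
Qed.

Lemma differentiable_dotl_comp (G : 'rV[R]_n -> 'rV[R]_n) u x :
  differentiable G x -> differentiable (fun z => dot (G z) u) x.
Proof.
move=> dG; have dl := @differentiable_dotl u (G x).
exact: (@differentiable_comp _ _ _ _ G (fun w => dot w u)).
Qed.

(** A vector-valued map only obeys a mean value theorem componentwise: the point
    [x + t *: v] depends on the direction [u] of the test. *)
Lemma gradient_mean_value (f : 'rV[R]_n -> R) x v u :
  (forall z, differentiable (grad f) z) ->
  exists2 t : R, 0 <= t <= 1 &
    dot (grad f (x + v) - grad f x) u = dot (v *m hess f (x + t *: v)) u.
Proof.
move=> dg.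
have [t t01 e] := @mean_value (fun z => dot (grad f z) u) x v
  (fun z => differentiable_dotl_comp u (dg z)).
by exists t => //; rewrite dotBl e derive_dotl.
Qed.

Lemma second_difference (f : 'rV[R]_n -> R) x u v :
  (forall z, differentiable f z) -> (forall z, differentiable (grad f) z) ->
  exists r s : R, [/\ 0 <= r <= 1, 0 <= s <= 1 &
    f (x + u + v) - f (x + u) - (f (x + v) - f x) =
    dot (v *m hess f (x + r *: u + s *: v)) u].
Proof.
move=> df dg; have dfv z : differentiable (fun z => f (z + v)) z.
  have dv : differentiable (fun z : 'rV[R]_n => z + v) z by [].
  exact: (differentiable_comp dv (df (z + v))).
pose F : 'rV[R]_n -> R := (fun z => f (z + v)) - f.
have dF z : differentiable F z by exact: differentiableB.
have [r r01 e] := mean_value x u dF.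
have [s s01 e'] := gradient_mean_value (x + r *: u) v u dg.
exists r, s; split=> //; rewrite -e' -[LHS]/(F (x + u) - F x) e.
rewrite deriveB; [|by apply: diff_derivable..].
rewrite dotBl -!derive_gradE //; congr (_ - _).
apply: (congr1 (fun g : R -> R => lim (g @ 0^'))); apply/funext => h /=.
by rewrite !addrA.
Qed.

(** Shrinking [u] and [v] along two basis vectors makes all evaluation points
    converge to [x]. *)
Lemma sym_of_mixed_values (M : 'rV[R]_n -> 'M[R]_n) x :
  {for x, continuous M} ->
  (forall u v, exists r s r' s' : R,
    [/\ 0 <= r <= 1, 0 <= s <= 1, 0 <= r' <= 1, 0 <= s' <= 1 &
     dot (v *m M (x + r *: u + s *: v)) u =
     dot (u *m M (x + r' *: v + s' *: u)) v]) ->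
  (M x)^T = M x.
Proof.
move=> cM mixed; apply/matrixP => i j; rewrite mxE.
apply/eqP; rewrite -subr_eq0 -normr_le0; apply/ler_addgt0Pl => e e0.
rewrite addr0.
have e2 : 0 < e / 2 by rewrite divr_gt0.
have near_entry k l : exists2 d : R, 0 < d & forall z, `|z - x| < d ->
    `|M z k l - M x k l| < e / 2.
  have hc : {for x, continuous (fun z => M z k l)}.
    apply: (@continuous_comp _ _ _ M (fun A => A k l)) => //.
    exact: coord_continuous.
  have /cvgrPdist_lt/(_ _ e2)/nbhs_ballP[d d0 hd] := hc.
  exists d => // z hz; rewrite distrC; apply: hd.
  by rewrite -ball_normE /= distrC.
have [d1 d10 hd1] := near_entry i j.
have [d2 d20 hd2] := near_entry j i.
pose u : 'rV[R]_n := delta_mx 0 i; pose v : 'rV[R]_n := delta_mx 0 j.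
pose K := `|u| + `|v| + 1.
have K0 : 0 < K by rewrite ltr_wpDl // addr_ge0.
pose t := Num.min d1 d2 / (2 * K).
have t0 : 0 < t by rewrite divr_gt0 ?mulr_gt0 // lt_min d10.
have [tK1 tK2] : t * K < d1 /\ t * K < d2.
  have -> : t * K = Num.min d1 d2 / 2 by rewrite /t; field; rewrite gt_eqF.
  have m0 : 0 < Num.min d1 d2 by rewrite lt_min d10.
  have m1 : Num.min d1 d2 <= d1 by rewrite ge_min lexx.
  have m2 : Num.min d1 d2 <= d2 by rewrite ge_min lexx orbT.
  by split; lra.
clearbody t.
have close (a b : 'rV[R]_n) (r s : R) : `|a| + `|b| + 1 = K ->
    0 <= r <= 1 -> 0 <= s <= 1 ->
    `|x + r *: (t *: a) + s *: (t *: b) - x| <= t * K.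
  move=> <- /andP[r0 r1] /andP[s0 s1].
  rewrite (addrAC _ (s *: _)) (addrAC x) subrr add0r (le_trans (ler_normD _ _)) //.
  rewrite !normrZ !ger0_norm //; try exact: ltW.
  have ha : r * (t * `|a|) <= t * `|a|.
    by rewrite ler_piMl // mulr_ge0 // ltW.
  have hb : s * (t * `|b|) <= t * `|b|.
    by rewrite ler_piMl // mulr_ge0 // ltW.
  rewrite !mulrDr mulr1; apply: le_trans (lerD ha hb) _.
  by rewrite lerDl ltW.
have entry (A : 'M[R]_n) k l :
    dot (t *: delta_mx 0 k *m A) (t *: delta_mx 0 l) = t ^+ 2 * A k l.
  by rewrite -scalemxAl dotZl dotZr dot_delta -rowE mxE mulrA expr2.
have [r [s [r' [s' [r01 s01 r01' s01' mix]]]]] := mixed (t *: u) (t *: v).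
rewrite !entry in mix.
have t2 : t ^+ 2 != 0 by rewrite expf_neq0 // gt_eqF.
have {mix} hxi := mulfI t2 mix.
have h1 := hd2 _ (le_lt_trans (close u v r s erefl r01 s01) tK2).
have Kvu : `|v| + `|u| + 1 = K by rewrite /K (addrC `|v|).
have h2 := hd1 _ (le_lt_trans (close v u r' s' Kvu r01' s01') tK1).
rewrite hxi distrC in h1.
apply: le_trans (ler_distD _ _ _) _; rewrite (splitr e).
exact: lerD (ltW h1) (ltW h2).
Qed.

(** Schwarz's theorem, by evaluating a mixed second difference of [f] in both
    orders and letting its step tend to zero. *)
Lemma hess_sym (f : 'rV[R]_n -> R) x :
  twice_continuously_differentiable f -> (hess f x)^T = hess f x.
Proof.
case=> df dg ch; apply: sym_of_mixed_values; first exact: ch.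
move=> u v.
have [r [s [r01 s01 e1]]] := second_difference x u v df dg.
have [r' [s' [r01' s01' e2]]] := second_difference x v u df dg.
exists r, s, r', s'; split=> //.
apply: etrans (esym e1) (etrans _ e2).
have swap (c1 c2 c3 c4 : R) : c1 - c2 - (c3 - c4) = c1 - c3 - (c2 - c4) by ring.
by rewrite (addrAC x u v) swap.
Qed.

Section UniformlyConvex.
Variables (f : 'rV[R]_n -> R) (mu l : R).
Hypothesis C2 : twice_continuously_differentiable f.
Hypothesis mu_gt0 : 0 < mu.
Hypothesis hess_bounds : forall x v,
  mu * enorm v ^+ 2 <= dot (v *m hess f x) v <= l * enorm v ^+ 2.

Let dg : forall z, differentiable (grad f) z.
Proof. by case: C2. Qed.

Lemma grad_strongly_monotone x y :
  mu * enorm (x - y) ^+ 2 <= dot (grad f x - grad f y) (x - y).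
Proof.
have [t _] := gradient_mean_value y (x - y) (x - y) dg.
rewrite [y + (x - y)]addrC subrK => ->.
by have /andP[] := hess_bounds (y + t *: (x - y)) (x - y).
Qed.

Lemma grad_lipschitz x y : 0 <= l ->
  enorm (grad f x - grad f y) <= l * enorm (x - y).
Proof.
move=> l0; apply: enorm_le_dot; first by rewrite mulr_ge0 ?enorm_ge0.
have [t _] := gradient_mean_value y (x - y) (grad f x - grad f y) dg.
rewrite [y + (x - y)]addrC subrK => ->.
apply: sym_form_le; first exact: hess_sym.
move=> v; have /andP[h1 ->] := hess_bounds (y + t *: (x - y)) v.
by rewrite andbT (le_trans _ h1) // mulr_ge0 ?exprn_ge0 ?enorm_ge0 // ltW.
Qed.

(** A short gradient step from a minimizer cannot decrease [f], while by the
    mean value theorem and the Lipschitz bound the decrease is at least half of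
    the one predicted by the gradient. *)
Lemma minimizer_grad_eq0 xs : 0 < l -> minimizer f xs -> grad f xs = 0.
Proof.
move=> l0 hmin; set g := grad f xs; pose k := (2 * l)^-1.
have k0 : 0 < k by rewrite invr_gt0 mulr_gt0.
have lk : l * k = 1 / 2 by rewrite /k; field; rewrite gt_eqF.
clearbody k.
have [t /andP[t0 t1]] := mean_value xs (- (k *: g)) (let: And3 h _ _ := C2 in h).
rewrite derive_gradE; last by case: C2.
have := hmin (xs - k *: g); rewrite -subr_ge0 => + e; rewrite e {e}.
set h := grad f (xs + _) => hg.
have {}hg : dot h g <= 0.
  by move: hg; rewrite dotNr dotZr oppr_ge0 pmulr_rle0.
have lip : enorm (h - g) <= 1 / 2 * enorm g.
  apply: le_trans (grad_lipschitz _ _ (ltW l0)) _.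
  rewrite addrAC subrr add0r enormZ enormN enormZ !ger0_norm ?(ltW k0) //.
  by rewrite mulrCA [l * _]mulrA lk ler_piMl // mulr_ge0 ?enorm_ge0 // divr_ge0.
have := normr_dot_le (h - g) g; rewrite dotBl ler_norml => /andP[lo _].
have := ler_wpM2r (enorm_ge0 g) lip.
apply: contraTeq; rewrite -enorm_gt0 => gp; rewrite -ltNge.
have g2 : 0 < enorm g ^+ 2 by exact: exprn_gt0.
by have := sqr_enorm g; rewrite !expr2 in g2 *; lra.
Qed.

End UniformlyConvex.

(** The mean value theorem, applied to the gradient minus its linear part at
    [xs], whose derivative is at most [L * r] on the ball of radius [r]. *)
Lemma grad_near_affine (f : 'rV[R]_n -> R) xs (L r : R) :
  (forall z, differentiable (grad f) z) -> 0 <= L ->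
  (forall x, enorm (x - xs) <= r ->
     opnorm (hess f x - hess f xs) <= L * enorm (x - xs)) ->
  forall x y, enorm (x - xs) <= r -> enorm (y - xs) <= r ->
    enorm (grad f x - grad f y - (x - y) *m hess f xs) <=
    L * r * enorm (x - y).
Proof.
move=> dg L0 hL x y hx hy.
have r0 : 0 <= r by apply: le_trans hx; exact: enorm_ge0.
set d := grad f x - grad f y - _.
apply: enorm_le_dot; first by rewrite !mulr_ge0 ?enorm_ge0.
have [t /andP[t0 t1]] := gradient_mean_value y (x - y) d dg.
rewrite [y + (x - y)]addrC subrK => e.
rewrite {1}/d dotBl e -dotBl -mulmxBr.
apply: le_trans (dot_le_enorm _ _) _; apply: ler_wpM2r; first exact: enorm_ge0.
apply: le_trans (enorm_mulmx_le _ _) _; apply: ler_wpM2r; first exact: enorm_ge0.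
have ht : enorm (y + t *: (x - y) - xs) <= r.
  have -> : y + t *: (x - y) - xs = t *: (x - xs) + (1 - t) *: (y - xs).
    by apply/rowP => i; rewrite !mxE; ring.
  apply: le_trans (ler_enormD _ _) _; rewrite !enormZ !ger0_norm ?subr_ge0 //.
  have h1 : t * enorm (x - xs) <= t * r by apply: ler_wpM2l.
  have h2 : (1 - t) * enorm (y - xs) <= (1 - t) * r.
    by apply: ler_wpM2l => //; rewrite subr_ge0.
  lra.
by apply: le_trans (hL _ ht) _; apply: ler_wpM2l.
Qed.

End MeanValue.

(** * Spectral decomposition of a real symmetric matrix *)

Section Spectral.
Local Open Scope sesquilinear_scope.

Lemma Re_sum (R : rcfType) (I : finType) (F : I -> complex R) :
  complex.Re (\sum_i F i) = \sum_i complex.Re (F i).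
Proof. by rewrite (@big_morph _ _ (@complex.Re R) 0 +%R) // => -[? ?] [? ?]. Qed.

Lemma Im_sum (R : rcfType) (I : finType) (F : I -> complex R) :
  complex.Im (\sum_i F i) = \sum_i complex.Im (F i).
Proof. by rewrite (@big_morph _ _ (@complex.Im R) 0 +%R) // => -[? ?] [? ?]. Qed.

(** The real and imaginary parts of a unitary basis diagonalising [A] over the
    complex numbers form a Parseval frame of real eigenvectors. Such a frame has
    twice as many vectors as a basis, some of them possibly zero, but serves
    the same purpose as an orthonormal eigenbasis: it splits every vector into
    coordinates on which [A] acts diagonally and whose squares add up to the
    squared norm. *)
Lemma symmetric_eigenframe (R : realType) (n : nat) (A : 'M[R]_n) :
  A^T = A ->
  exists (lam : 'I_n * bool -> R) (p : 'I_n * bool -> 'rV[R]_n),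
    (forall i, p i *m A = lam i *: p i) /\
    (forall v, \sum_i dot (p i) v ^+ 2 = dot v v).
Proof.
move=> symA; pose AC := map_mx (real_complex R) A.
have hA : AC \is hermsymmx.
  apply: realsym_hermsym.
    by apply/is_hermitianmxP; rewrite expr0 scale1r map_mx_id // map_trmx symA.
  by apply/mxOverP => i j; rewrite mxE complex_real.
have /hermitian_normalmx/orthomx_spectralP := hA.
have := hermitian_spectral_diag_real hA.
have := spectral_unitarymx AC.
move: (spectralmx AC) (spectral_diag AC) => P D uP rD eA.
have PA : P *m AC = diag_mx D *m P.
  by rewrite eA !mulmxA mulmxV ?unitarymx_unit // mul1mx.
pose p (i : 'I_n * bool) : 'rV[R]_n :=
  \row_j (if i.2 then complex.Im (P i.1 j) else complex.Re (P i.1 j)).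
exists (fun i => complex.Re (D 0 i.1)), p; split.
  case=> i b; apply/rowP => j.
  have := congr1 (fun M : 'M[complex R]_n => M i j) PA; rewrite mul_diag_mx !mxE /=.
  have /complex_realP[d ->] := mxOverP rD 0 i.
  move=> h; case: b => /=.
    move: h => /(congr1 (@complex.Im R)); rewrite Im_sum /=.
    case: (P i j) => x y /=; rewrite mul0r addr0 => <-.
    apply: eq_bigr => k _; rewrite !mxE /=; case: (P i k) => ? ? /=; ring.
  move: h => /(congr1 (@complex.Re R)); rewrite Re_sum /=.
  case: (P i j) => x y /=; rewrite mul0r subr0 => <-.
  apply: eq_bigr => k _; rewrite !mxE /=; case: (P i k) => ? ? /=; ring.
move=> v; pose vC := map_mx (real_complex R) v.
have PP : P^t* *m P = 1%:M by apply: mulmx1C; apply/unitarymxP.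
have := congr1 (fun M => (vC *m M *m vC^T) 0 0) PP.
rewrite mulmx1 !mulmxA -[X in X *m vC^T]mulmxA -!mulmxA mulmxA.
have -> : vC *m P^t* = (P *m vC^T)^t*.
  rewrite trmx_mul map_mxM trmxK; congr (_ *m _).
  by apply/rowP => j; rewrite !mxE; apply/esym/CrealP; rewrite complex_real.
set z := P *m vC^T => /(congr1 (@complex.Re R)).
rewrite mxE Re_sum => hz.
have -> : dot v v = complex.Re ((vC *m vC^T) 0 0).
  rewrite mxE Re_sum; apply: eq_bigr => j _.
  by rewrite !mxE /= mulr0 subr0.
rewrite -hz -(pair_bigA _ (fun i b => dot (p (i, b)) v ^+ 2)) /=.
apply: eq_bigr => i _; rewrite big_bool /=.
have -> : dot (p (i, true)) v = complex.Im (z i 0).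
  rewrite mxE Im_sum; apply: eq_bigr => j _; rewrite !mxE /=.
  by case: (P i j) => ? ? /=; ring.
have -> : dot (p (i, false)) v = complex.Re (z i 0).
  rewrite mxE Re_sum; apply: eq_bigr => j _; rewrite !mxE /=.
  by case: (P i j) => ? ? /=; ring.
have -> : z^t* 0 i = conjc (z i 0) by rewrite 2!mxE.
by case: (z i 0) => x y /=; ring.
Qed.

End Spectral.

(** * Contraction of perturbed gradient iterations *)

Lemma ltr_expr_small (R : realType) (q eps : R) :
  0 <= q -> q < 1 -> 0 < eps -> exists j : nat, q ^+ j <= eps.
Proof.
move=> q0 q1 e0.
have := @cvg_expr R q; rewrite ger0_norm // => /(_ q1).
move=> /cvgrPdist_le/(_ _ e0)[j _ /(_ j (leqnn j))].
rewrite sub0r normrN => h; exists j; exact: le_trans (ler_norm _) h.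
Qed.

(** Whenever [u k] is not small, the sequence contracts one step later; and
    whenever it is small, two steps cannot push it above [eta]. Hence [u] decays
    geometrically until it drops below [eta], and stays there. *)
Lemma delayed_decay (R : realType) (u : nat -> R) (C q theta tau eta : R)
    (m N : nat) :
  0 <= C -> 0 <= q -> q < 1 -> 0 <= eta ->
  C * (C * theta + tau) + tau <= eta -> tau <= (1 - q) / 2 * eta ->
  (forall k, (k < N)%N -> u k.+1 <= C * u k + tau) ->
  (forall k, (m <= k)%N -> (k.+1 < N)%N -> theta <= u k ->
     u k.+2 <= q * u k.+1 + tau) ->
  forall j, (m.+1 + j <= N)%N ->
    u (m.+1 + j)%N <= Num.max eta (((1 + q) / 2) ^+ j * u m.+1).
Proof.
move=> C0 q0 q1 eta0 hC ht grow dec; elim=> [|j IH] hj.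
  by rewrite addn0 expr0 mul1r le_max lexx orbT.
have {}IH := IH (ltnW (leq_trans (_ : _ < _)%N hj)).
have {IH} IH : u (m.+1 + j)%N <= Num.max eta (((1 + q) / 2) ^+ j * u m.+1).
  by apply: IH; rewrite addnS.
rewrite addnS addSn in hj *; rewrite addSn in IH.
have [small|big] := ltP (u (m + j)%N) theta.
  rewrite le_max; apply/orP; left; apply: le_trans hC.
  apply: le_trans (grow _ hj) _; rewrite lerD2r ler_wpM2l //.
  apply: le_trans (grow _ (ltnW hj)) _; rewrite lerD2r ler_wpM2l //.
  exact: ltW.
have hd := dec _ (leq_addr j m) hj big.
rewrite le_max exprS -mulrA.
set X := _ ^+ j * _ in IH *.
have [le_eta|gt_eta] := leP (u (m + j).+1) eta; apply/orP.
  left; have := ler_wpM2l q0 le_eta; nra.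
right; move: IH; rewrite le_max leNgt gt_eta /= => leX.
have := ler_wpM2l q0 leX; nra.
Qed.

Section LocalContraction.
Context {R : realType} {n : nat} {I : finType}.
Variables (H : 'M[R]_n) (lam : I -> R) (p : I -> 'rV[R]_n) (mu l a b : R).
Hypothesis symH : H^T = H.
Hypothesis mu_gt0 : 0 < mu.
Hypothesis H_bounds : forall v,
  mu * enorm v ^+ 2 <= dot (v *m H) v <= l * enorm v ^+ 2.
Hypothesis eigen : forall i, p i *m H = lam i *: p i.
Hypothesis parseval : forall v, \sum_i dot (p i) v ^+ 2 = dot v v.
Hypothesis mu_le_l : mu <= l.
Hypothesis a_gt0 : 0 < a.
Hypothesis b_gt0 : 0 < b.
Implicit Types (v : 'rV[R]_n).

Let l_gt0 : 0 < l. Proof. exact: lt_le_trans mu_le_l. Qed.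

Lemma coord_mulmx i v : dot (p i) (v *m H) = lam i * dot (p i) v.
Proof. by rewrite dotC dot_mulmx_sym // eigen dotZl. Qed.

Lemma coord_le i v : `|dot (p i) v| <= enorm v.
Proof.
rewrite -sqrtr_sqr ler_sqrt ?dot_ge0 // -parseval (bigD1 i) //= lerDl.
by apply: sumr_ge0 => j _; exact: sqr_ge0.
Qed.

Lemma parseval_mulmx v : dot (v *m H) v = \sum_i lam i * dot (p i) v ^+ 2.
Proof.
have polar (x y : 'rV[R]_n) : 2 * dot x y = dot (x + y) (x + y) - dot x x - dot y y.
  by rewrite !dot_lin (dotC y x); ring.
apply: (mulfI (_ : 2 != 0 :> R)) => //.
rewrite polar -!parseval -!sumrB mulr_sumr; apply: eq_bigr => i _.
by rewrite dotDr coord_mulmx; ring.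
Qed.

Lemma eigenvalue_bounds i : p i != 0 -> mu <= lam i <= l.
Proof.
rewrite -enorm_gt0 => pi0; have := H_bounds (p i).
rewrite eigen dotZl -sqr_enorm.
by rewrite !ler_pM2r ?exprn_gt0.
Qed.

(** If the coordinate [i] of [g] dominates those with smaller eigenvalue, the
    Rayleigh quotient of [g] is at least [3 / 4 * lam i]. The bound [3 / 2] then
    keeps [1 - alpha * lam i] above [- 1 / 2]. *)
Lemma rayleigh_bound (i : I) (g : 'rV[R]_n) (alpha s t : R) :
  p i != 0 -> 0 < t -> t <= `|dot (p i) g| ->
  (forall j, lam j < lam i -> `|dot (p j) g| <= s) ->
  4 * #|I|%:R * s ^+ 2 <= t ^+ 2 -> 0 <= alpha ->
  alpha * (dot (g *m H) g - mu / 12 * dot g g) <= dot g g ->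
  alpha * lam i <= 3 / 2.
Proof.
move=> pi0 t0 ht hs hst alpha0 hal.
have /andP[lam_lo lam_hi] := eigenvalue_bounds pi0.
have lam0 : 0 < lam i by exact: lt_le_trans lam_lo.
have g_ge : t ^+ 2 <= dot g g.
  rewrite -sqr_enorm ler_pXn2r ?nnegrE ?enorm_ge0 //; last exact: ltW.
  exact: le_trans ht (coord_le i g).
have g0 : 0 < dot g g by rewrite (lt_le_trans _ g_ge) // exprn_gt0.
have hsum : lam i * dot g g - dot (g *m H) g <= lam i * (#|I|%:R * s ^+ 2).
  rewrite parseval_mulmx -parseval mulr_sumr -sumrB mulr_natl -sumr_const.
  rewrite mulr_sumr; apply: ler_sum => j _; rewrite -mulrBl.
  have [pj0|pj0] := eqVneq (p j) 0.
    by rewrite pj0 dot0l expr0n mulr0 mulr_ge0 ?sqr_ge0 // ltW.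
  have /andP[lamj _] := eigenvalue_bounds pj0.
  have [lt_ji|le_ij] := ltP (lam j) (lam i).
    apply: ler_pM; rewrite ?sqr_ge0 ?subr_ge0 ?(ltW lt_ji) //.
      by rewrite lerBlDr lerDl (le_trans _ lamj) // ltW.
    rewrite -real_normK ?num_real // ler_pXn2r ?nnegrE ?normr_ge0 //.
      exact: hs.
    exact: le_trans (normr_ge0 _) (hs _ lt_ji).
  apply: le_trans (_ : 0 <= _); last by rewrite mulr_ge0 ?sqr_ge0 // ltW.
  by rewrite mulr_le0_ge0 ?sqr_ge0 // subr_le0.
have h1 : 2 / 3 * lam i * dot g g <= dot (g *m H) g - mu / 12 * dot g g.
  have h2 : lam i * (4 * #|I|%:R * s ^+ 2) <= lam i * dot g g.
    by rewrite ler_pM2l // (le_trans hst).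
  have h3 : mu * dot g g <= lam i * dot g g by rewrite ler_pM2r.
  lra.
have h4 := le_trans (ler_wpM2l alpha0 h1) hal.
rewrite -(ler_pM2r g0); lra.
Qed.

(** The last clause abstracts the Barzilai-Borwein rule: up to an error, the
    step is at most the inverse Rayleigh quotient of [H] along the previous
    step, which is parallel to [g k]. The fraction of [mu] is one that
    [rayleigh_bound] can absorb. *)
Definition gradient_run (e g : nat -> 'rV[R]_n) (alpha : nat -> R) : Prop :=
  [/\ forall k, e k.+1 = e k - alpha k *: g k,
      forall k, a <= alpha k <= b &
      forall k, alpha k.+1 *
        (dot (g k *m H) (g k) - mu / 12 * dot (g k) (g k)) <= dot (g k) (g k)].

Lemma coord_step e g alpha i k : gradient_run e g alpha ->
  `|dot (p i) (e k.+1)| <=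
  `|1 - alpha k * lam i| * `|dot (p i) (e k)| +
  b * enorm (g k - e k *m H).
Proof.
case=> -> /(_ k)/andP[ak bk] _; set r := g k - _.
have -> : g k = e k *m H + r by rewrite /r addrC subrK.
have -> : dot (p i) (e k - alpha k *: (e k *m H + r)) =
    (1 - alpha k * lam i) * dot (p i) (e k) - alpha k * dot (p i) r.
  by rewrite !dot_lin coord_mulmx; ring.
apply: le_trans (ler_normB _ _) _; rewrite !normrM lerD2l.
apply: ler_pM; rewrite ?normr_ge0 ?coord_le //.
by rewrite ger0_norm // (le_trans (ltW a_gt0)).
Qed.

Let K : R := #|I|%:R + 1.
(* [C] bounds the growth of a coordinate in any step, and [q] its growth in a
   step that satisfies the conclusion of [rayleigh_bound]. *)
Let C := 1 + b * l.
Let q := Num.max (1 / 2) (1 - a * mu).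

(** The coordinate [i] decays provided all coordinates with smaller eigenvalue
    have already become small: as long as it is not small itself, it dominates
    the Rayleigh quotient, so that the next step is short enough to contract
    it. *)
Lemma coord_decay_step (eta : R) : 0 < eta ->
  exists theta tau eta' : R, [/\ 0 < theta, 0 < tau <= 1, 0 < eta',
    C * (C * theta + b * tau) + b * tau <= eta /\
    b * tau <= (1 - q) / 2 * eta &
    forall e g alpha i k, gradient_run e g alpha -> p i != 0 ->
    0 < enorm (e 0%N) ->
    enorm (g k - e k *m H) <= tau * enorm (e 0%N) ->
    enorm (g k.+1 - e k.+1 *m H) <= tau * enorm (e 0%N) ->
    (forall j, lam j < lam i -> `|dot (p j) (e k)| <= eta' * enorm (e 0%N)) ->
    theta * enorm (e 0%N) <= `|dot (p i) (e k)| ->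
    `|dot (p i) (e k.+2)| <=
      q * `|dot (p i) (e k.+1)| + b * tau * enorm (e 0%N)].
Proof.
move=> eta0.
have K1 : 1 <= K by rewrite /K lerDr ler0n.
have K0 : 0 < K by exact: lt_le_trans K1.
have C1 : 1 <= C by rewrite /C lerDl mulr_ge0 ?ltW.
have C0 : 0 < C by exact: lt_le_trans C1.
have q1 : q < 1.
  by rewrite /q gt_max ltr_pdivrMr // mul1r ltr1n ltrBlDr ltrDl mulr_gt0.
(* Two arbitrary steps from below [theta] end below [eta / 2]. The gradient
   coordinates below [s] are those that [rayleigh_bound] tolerates when the
   coordinate [i] of the error is at least [theta]. Finally [t1] and [t2] keep
   the errors within the remaining [eta / 2] and within the gap left by the
   contraction factor [q]. *)
pose theta := eta / (2 * C ^+ 2).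
have theta0 : 0 < theta by rewrite divr_gt0 // mulr_gt0 // exprn_gt0.
pose s := mu * theta / (4 * K).
have s0 : 0 < s by rewrite divr_gt0 // mulr_gt0.
pose t1 := eta / (2 * b * (C + 1)).
have t10 : 0 < t1 by rewrite divr_gt0 // !mulr_gt0 // addr_gt0.
pose t2 := (1 - q) / 2 * eta / b.
have t20 : 0 < t2 by rewrite divr_gt0 // mulr_gt0 // divr_gt0 // subr_gt0.
pose tau := Num.min (Num.min 1 (s / 2)) (Num.min t1 t2).
have [tau_1 tau_s tau_t1 tau_t2] : [/\ tau <= 1, tau <= s / 2, tau <= t1 & tau <= t2].
  by rewrite /tau; split; rewrite !ge_min lexx ?orbT.
have tau0 : 0 < tau by rewrite !lt_min ltr01 t10 t20 divr_gt0.
exists theta, tau, (s / (2 * l)); split=> //.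
  by rewrite tau0.
- by rewrite divr_gt0 // mulr_gt0.
- split; last first.
    have -> : (1 - q) / 2 * eta = b * t2 by rewrite /t2; field; rewrite gt_eqF.
    by rewrite ler_pM2l.
  have h1 : C ^+ 2 * theta = eta / 2.
    by rewrite /theta; field; rewrite gt_eqF.
  have h2 : b * (C + 1) * tau <= eta / 2.
    have -> : eta / 2 = b * (C + 1) * t1.
      by rewrite /t1; field; rewrite !gt_eqF // addr_gt0.
    by rewrite ler_pM2l // mulr_gt0 // addr_gt0.
  rewrite (_ : _ + _ = C ^+ 2 * theta + b * (C + 1) * tau); last by ring.
  lra.
move=> e g alpha i k run pi0 E0 rk rk1 low big.
set E := enorm _ in E0 rk rk1 low big *.
have /andP[lam_lo lam_hi] := eigenvalue_bounds pi0.
have coord_g j : dot (p j) (g k) = lam j * dot (p j) (e k) + dot (p j) (g k - e k *m H).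
  by rewrite dotBr coord_mulmx addrC subrK.
have coord_r j : `|dot (p j) (g k - e k *m H)| <= s / 2 * E.
  apply: le_trans (coord_le _ _) _; apply: le_trans rk _.
  by rewrite ler_wpM2r // ltW.
have sK : s <= mu * theta / 4.
  rewrite /s ler_pM2l; last exact: mulr_gt0.
  by rewrite lef_pV2 ?posrE // ?mulr_gt0 // ler_peMr.
have sdef : mu * theta = 4 * K * s by rewrite /s; field; rewrite gt_eqF.
clearbody tau E s theta.
have step : alpha k.+1 * lam i <= 3 / 2.
  have [_ /(_ k.+1)/andP[ak _] /(_ k) hk] := run.
  apply: (@rayleigh_bound i (g k) _ (s * E) (mu * theta / 2 * E)) => //.
  - by rewrite mulr_gt0 // divr_gt0 // mulr_gt0.
  - have h1 : mu * (theta * E) <= lam i * `|dot (p i) (e k)|.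
      by apply: ler_pM => //; [exact: ltW | rewrite mulr_ge0 // ltW].
    have h2 : lam i * `|dot (p i) (e k)| <= `|dot (p i) (g k)| + s / 2 * E.
      have lam0 : 0 <= lam i by rewrite (le_trans _ lam_lo) // ltW.
      rewrite -(ger0_norm lam0) -normrM.
      have -> : lam i * dot (p i) (e k) =
          dot (p i) (g k) - dot (p i) (g k - e k *m H) by rewrite coord_g addrK.
      by apply: le_trans (ler_normB _ _) _; rewrite lerD2l.
    have h3 : s * E <= mu * theta / 4 * E by rewrite ler_wpM2r // ltW.
    have h4 : 0 < mu * theta * E by rewrite mulr_gt0 // mulr_gt0.
    lra.
  - move=> j /low lowj.
    have [pj0|pj0] := eqVneq (p j) 0.
      by rewrite pj0 dot0l normr0 mulr_ge0 // ltW.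
    have /andP[lamj lamj'] := eigenvalue_bounds pj0.
    have lamj0 : 0 <= lam j by rewrite (le_trans _ lamj) // ltW.
    rewrite coord_g; apply: le_trans (ler_normD _ _) _.
    rewrite normrM (ger0_norm lamj0).
    have h1 : lam j * `|dot (p j) (e k)| <= l * (s / (2 * l) * E).
      by apply: ler_pM => //; rewrite (le_trans _ lamj) // ltW.
    have h2 : l * (s / (2 * l) * E) = s / 2 * E by field; rewrite gt_eqF.
    rewrite h2 in h1.
    apply: le_trans (lerD h1 (coord_r j)) _; lra.
  - rewrite sdef exprMn mulrA.
    have -> : (4 * K * s / 2 * E) ^+ 2 = 4 * K ^+ 2 * s ^+ 2 * E ^+ 2 by field.
    rewrite ler_wpM2r ?exprn_ge0 ?(ltW E0) //.
    rewrite ler_wpM2r ?exprn_ge0 ?(ltW s0) // ler_pM2l //.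
    rewrite expr2; apply: le_trans (_ : K <= _); first by rewrite /K lerDl.
    by rewrite ler_peMr // ltW.
  - by rewrite (le_trans _ ak) // ltW.
apply: le_trans (coord_step i k.+1 run) _; apply: lerD; last first.
  by rewrite -mulrA ler_wpM2l // ltW.
rewrite ler_wpM2r // /q le_max !ler_norml.
have [_ /(_ k.+1)/andP[ak _] _] := run.
have h : a * mu <= alpha k.+1 * lam i.
  by apply: ler_pM => //; exact: ltW.
by case: (leP (1 - alpha k.+1 * lam i) (1 / 2)) => ?; apply/orP;
  [left|right]; apply/andP; split; lra.
Qed.

Lemma coord_growth e g alpha i k t : gradient_run e g alpha -> p i != 0 ->
  enorm (g k - e k *m H) <= t ->
  `|dot (p i) (e k.+1)| <= C * `|dot (p i) (e k)| + b * t.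
Proof.
move=> run pi0 ht; apply: le_trans (coord_step i k run) _.
have /andP[lam_lo lam_hi] := eigenvalue_bounds pi0.
have [_ /(_ k)/andP[ak bk] _] := run.
have lam0 : 0 <= lam i by rewrite (le_trans _ lam_lo) // ltW.
have alpha0 : 0 <= alpha k by rewrite (le_trans _ ak) // ltW.
have h : alpha k * lam i <= b * l by exact: ler_pM.
have h0 : 0 <= alpha k * lam i by exact: mulr_ge0.
apply: lerD; last by rewrite ler_wpM2l // ltW.
by rewrite ler_wpM2r // /C ler_norml; apply/andP; split; lra.
Qed.

(** All coordinates decay, by induction on the number of smaller eigenvalues.
    Neither the waiting time [m] nor the admissible error [tau] depends on the
    time [k] at which the bound is claimed, so that [k] can be chosen first. *)
Lemma coords_decay (c : nat) (eta : R) : 0 < eta ->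
  exists (m : nat) (tau : R), 0 < tau /\
    forall e g alpha i k, gradient_run e g alpha -> 0 < enorm (e 0%N) ->
    (#|[pred j | (lam j < lam i)%R]| < c)%N -> (m <= k)%N ->
    (forall j, (j < k)%N ->
       enorm (g j - e j *m H) <= tau * enorm (e 0%N)) ->
    `|dot (p i) (e k)| <= eta * enorm (e 0%N).
Proof.
elim: c eta => [|c IH] eta eta0; first by exists 0%N, 1.
have [theta [tau1 [eta' [theta0 /andP[tau10 tau11] eta'0 [hC ht] step]]]] :=
  coord_decay_step eta0.
have [m' [tau2 [tau20 {}IH]]] := IH _ eta'0.
have C1 : 1 <= C by rewrite /C lerDl mulr_ge0 ?ltW.
have C0 : 0 <= C by exact: le_trans C1.
have q0 : 0 <= q by rewrite /q le_max divr_ge0.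
have q1 : q < 1.
  by rewrite /q gt_max ltr_pdivrMr // mul1r ltr1n ltrBlDr ltrDl mulr_gt0.
pose D := C + b.
have D1 : 1 <= D by rewrite /D (le_trans C1) // lerDl ltW.
have Dm : 0 < D ^+ m'.+1 by rewrite exprn_gt0 // (lt_le_trans ltr01).
have [j0 hj0] : exists j, ((1 + q) / 2) ^+ j <= eta / D ^+ m'.+1.
  by apply: ltr_expr_small; [lra|lra|exact: divr_gt0].
exists (m'.+1 + j0)%N, (Num.min tau1 tau2).
split=> [|e g alpha i k run E0 rank_i hk res]; first by rewrite lt_min tau10.
have [pi0|pi0] := eqVneq (p i) 0.
  by rewrite pi0 dot0l normr0 mulr_ge0 // ltW.
have res1 j : (j < k)%N -> enorm (g j - e j *m H) <= tau1 * enorm (e 0%N).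
  by move/res/le_trans; apply; rewrite ler_wpM2r ?(ltW E0) // ge_min lexx.
have res2 j : (j < k)%N -> enorm (g j - e j *m H) <= tau2 * enorm (e 0%N).
  by move/res/le_trans; apply; rewrite ler_wpM2r ?(ltW E0) // ge_min lexx orbT.
set E := enorm _ in E0 res1 res2 *.
have grow j : (j < k)%N ->
    `|dot (p i) (e j.+1)| <= C * `|dot (p i) (e j)| + b * tau1 * E.
  by move=> /res1 /(coord_growth run pi0); rewrite mulrA.
have bound j : (j <= k)%N -> `|dot (p i) (e j)| <= D ^+ j * E.
  elim: j => [_|j IHj hj]; first by rewrite expr0 mul1r coord_le.
  apply: le_trans (grow j hj) _; rewrite exprS {1}/D.
  have -> : (C + b) * D ^+ j * E = C * (D ^+ j * E) + b * D ^+ j * E by ring.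
  apply: lerD; first by rewrite ler_wpM2l // IHj // ltnW.
  rewrite ler_wpM2r ?(ltW E0) // ler_pM2l //.
  by apply: le_trans tau11 _; exact: exprn_ege1.
have small j : (m' <= j)%N -> (j.+1 < k)%N ->
    theta * E <= `|dot (p i) (e j)| ->
    `|dot (p i) (e j.+2)| <= q * `|dot (p i) (e j.+1)| + b * tau1 * E.
  move=> mj jk; apply: (step _ _ _ _ _ run pi0 E0) => //; [exact/res1/ltnW|exact: res1|].
  move=> i' lt_i'; apply: IH (run) E0 _ mj _ => [|j' hj'].
    rewrite ltnS in rank_i; apply: leq_trans rank_i; apply: proper_card.
    apply/properP; split; last by exists i'; rewrite !inE ?ltxx.
    by apply/fintype.subsetP => x; rewrite !inE => /lt_trans; apply.
  by apply: res2; rewrite (ltn_trans hj') // ltnW.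
have E0' := ltW E0.
have hD := @delayed_decay R (fun k => `|dot (p i) (e k)|) C q (theta * E)
  (b * tau1 * E) (eta * E) m' k C0 q0 q1 (mulr_ge0 (ltW eta0) E0') _ _ grow small.
have le1 : (m'.+1 <= k)%N by rewrite (leq_trans _ hk) // leq_addr.
have {hD} := hD _ _ (k - m'.+1)%N; rewrite subnKC //.
move=> /(_ _ _ (leqnn k)) hD; apply: le_trans (hD _ _) _.
- by have := ler_wpM2r E0' hC; lra.
- by have := ler_wpM2r E0' ht; lra.
rewrite ge_max lexx /=.
apply: le_trans (_ : ((1 + q) / 2) ^+ j0 * (D ^+ m'.+1 * E) <= _).
  apply: ler_pM => //; [by rewrite exprn_ge0; lra| |exact: bound].
  by apply: ler_wiXn2l; [lra|lra|rewrite leq_subRL // leq_addr].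
by rewrite mulrA ler_wpM2r // -ler_pdivlMr.
Qed.

Lemma enorm_mulH v : enorm (v *m H) <= l * enorm v.
Proof.
apply: enorm_le_dot; first by rewrite mulr_ge0 ?enorm_ge0 // ltW.
apply: sym_form_le => // u; have /andP[h1 ->] := H_bounds u.
by rewrite andbT (le_trans _ h1) // mulr_ge0 ?exprn_ge0 ?enorm_ge0 // ltW.
Qed.

(** The errors allowed by [coords_decay] are relative to the initial distance,
    those supposed here to the current one; over the fixed number of steps [m]
    the two differ by a constant factor. *)
Theorem local_contraction : exists (m : nat) (delta : R),
  [/\ (0 < m)%N, 0 < delta &
    forall e g alpha, gradient_run e g alpha ->
    (forall k, enorm (g k - e k *m H) <= delta * enorm (e k)) ->
    enorm (e m) <= 1 / 2 * enorm (e 0%N)].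
Proof.
have K0 : 0 < K by rewrite /K ltr_wpDl // ler0n.
have eta0 : 0 < 1 / (2 * K) by rewrite divr_gt0 // mulr_gt0.
have [m [tau [tau0 decay]]] := coords_decay #|I|.+1 eta0.
pose D := 1 + b * (l + 1).
have D1 : 1 <= D by rewrite /D lerDl mulr_ge0 ?addr_ge0 // ltW.
have D0 : 0 < D by exact: lt_le_trans D1.
have Dm j : 0 < D ^+ j by rewrite exprn_gt0.
exists m.+1, (Num.min 1 (tau / D ^+ m.+1)).
split=> // [|e g alpha run res]; first by rewrite lt_min ltr01 divr_gt0.
have growth j : enorm (e j) <= D ^+ j * enorm (e 0%N).
  elim: j => [|j IH]; first by rewrite expr0 mul1r.
  have [-> /(_ j)/andP[aj bj] _] := run.
  have gj : enorm (g j) <= (l + 1) * enorm (e j).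
    rewrite -(subrK (e j *m H) (g j)).
    apply: le_trans (ler_enormD _ _) _; rewrite mulrDl mul1r addrC.
    apply: lerD; first exact: enorm_mulH.
    apply: le_trans (res j) _; rewrite ler_piMl ?enorm_ge0 //.
    by rewrite ge_min lexx.
  apply: le_trans (ler_enormB _ _) _; rewrite enormZ.
  apply: le_trans (_ : D * enorm (e j) <= _); last first.
    by rewrite exprS -mulrA ler_pM2l.
  rewrite /D mulrDl mul1r lerD2l -mulrA.
  apply: ler_pM; rewrite ?enorm_ge0 //.
  by rewrite ger0_norm // (le_trans (ltW a_gt0)).
have [e0|e0] := eqVneq (e 0%N) 0.
  by have := growth m.+1; rewrite e0 enorm0 !mulr0.
have E0 : 0 < enorm (e 0%N) by rewrite enorm_gt0.
have hres j : (j < m.+1)%N -> enorm (g j - e j *m H) <= tau * enorm (e 0%N).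
  move=> hj; apply: le_trans (res j) _.
  apply: le_trans (_ : tau / D ^+ m.+1 * (D ^+ j * enorm (e 0%N)) <= _).
    by apply: ler_pM; rewrite ?enorm_ge0 ?ge_min ?lexx ?orbT // le_min ler01 divr_ge0 // ltW.
  rewrite mulrA ler_pM2r // -mulrA ler_piMr ?(ltW tau0) // mulrC ler_pdivrMr // mul1r.
  by apply: ler_weXn2l => //; exact: ltnW.
have bound i : `|dot (p i) (e m.+1)| <= 1 / (2 * K) * enorm (e 0%N).
  by apply: decay run E0 _ (leqnSn m) hres; rewrite ltnS max_card.
rewrite -(@ler_pXn2r _ 2) ?nnegrE ?mulr_ge0 ?enorm_ge0 ?divr_ge0 //.
rewrite sqr_enorm -parseval.
apply: le_trans (_ : \sum_(i in I) (1 / (2 * K) * enorm (e 0%N)) ^+ 2 <= _).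
  apply: ler_sum => i _; rewrite -real_normK ?num_real //.
  by rewrite ler_pXn2r ?nnegrE // (le_trans _ (bound i)).
have ratio : #|I|%:R / K ^+ 2 <= 1.
  rewrite ler_pdivrMr ?exprn_gt0 // mul1r.
  apply: le_trans (_ : K <= _); first by rewrite /K lerDl.
  by rewrite expr2 ler_peMr ?(ltW K0) // /K lerDr ler0n.
rewrite sumr_const.
have -> : (1 / (2 * K) * enorm (e 0%N)) ^+ 2 *+ #|I| =
    (1 / 2 * enorm (e 0%N)) ^+ 2 * (#|I|%:R / K ^+ 2).
  by rewrite -[LHS]mulr_natl; field; rewrite gt_eqF.
by rewrite ler_piMr // exprn_ge0 // mulr_ge0 ?enorm_ge0 // divr_ge0.
Qed.

End LocalContraction.

(** * The stabilized Barzilai-Borwein iteration *)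

Section Iteration.
Context {R : realType} {n : nat}.
Variables (f : 'rV[R]_n -> R) (b : BB_choice) (mu l : R).
Hypothesis mu_gt0 : 0 < mu.
Hypothesis mu_le_l : mu <= l.
Hypothesis mono : forall x y,
  mu * enorm (x - y) ^+ 2 <= dot (grad f x - grad f y) (x - y).
Hypothesis lip : forall x y,
  enorm (grad f x - grad f y) <= l * enorm (x - y).

(* A lower bound for both Barzilai-Borwein step sizes. *)
Let a0 := mu / l ^+ 2.

Let l_gt0 : 0 < l. Proof. exact: lt_le_trans mu_le_l. Qed.

Let a0_gt0 : 0 < a0. Proof. by rewrite divr_gt0 // exprn_gt0. Qed.

Let a0_le : a0 * l <= 1.
Proof.
have -> : a0 * l = mu / l by rewrite /a0; field; rewrite gt_eqF.
by rewrite ler_pdivrMr // mul1r.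
Qed.

Lemma dot_diff_le x y :
  dot (x - y) (grad f x - grad f y) <= l * enorm (x - y) ^+ 2.
Proof.
apply: le_trans (dot_le_enorm _ _) _.
by rewrite expr2 mulrCA ler_wpM2l ?enorm_ge0.
Qed.

(** The second step size never exceeds the first one, by Cauchy-Schwarz, so
    both obey the upper bound that defines the first. *)
Lemma BB_stepsize_bounds x y : x != y ->
  let s := x - y in let g := grad f x - grad f y in
  a0 <= BB_stepsize b s g /\ BB_stepsize b s g * dot s g <= dot s s.
Proof.
move=> xy s g.
have s0 : 0 < enorm s by rewrite enorm_gt0 subr_eq0.
have ss0 : 0 < dot s s by rewrite -sqr_enorm exprn_gt0.
have hm : mu * dot s s <= dot s g by rewrite dotC -sqr_enorm; exact: mono.
have sg0 : 0 < dot s g by apply: lt_le_trans hm; exact: mulr_gt0.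
have gg : dot g g <= l ^+ 2 * dot s s.
  rewrite -!sqr_enorm -exprMn ler_pXn2r ?nnegrE ?mulr_ge0 ?enorm_ge0 ?(ltW l_gt0) //.
  exact: lip.
have g0 : 0 < dot g g.
  rewrite lt_def dot_ge0 andbT dot_eq0; apply: contraTneq sg0 => ->.
  by rewrite dot0r ltxx.
have cs : dot s g * dot s g <= dot s s * dot g g.
  have := dot_le_enorm s g; rewrite -!sqr_enorm -exprMn -expr2 => cs.
  by rewrite ler_pXn2r ?nnegrE ?mulr_ge0 ?enorm_ge0 ?(ltW sg0).
case: b; rewrite /BB_stepsize; split.
- rewrite ler_pdivlMr //.
  apply: le_trans (_ : a0 * (l * enorm s ^+ 2) <= _).
    by rewrite ler_pM2l //; exact: dot_diff_le.
  by rewrite mulrA sqr_enorm ler_piMl // dot_ge0.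
- by rewrite divfK // gt_eqF.
- rewrite ler_pdivlMr //; apply: le_trans hm.
  apply: le_trans (_ : a0 * (l ^+ 2 * dot s s) <= _); first by rewrite ler_pM2l.
  by rewrite mulrA /a0 divfK // gt_eqF // exprn_gt0.
- by rewrite mulrAC ler_pdivrMr.
Qed.

Variables (Delta : R) (x0 x1 : 'rV[R]_n).
Hypothesis Delta_gt0 : 0 < Delta.
Hypothesis x0x1 : x0 != x1.

Let x := BBstab b f Delta x0 x1.
Let g k := grad f (x k).

Lemma BBstabE k : x k.+2 = BBstab_next b f Delta (x k) (x k.+1).
Proof. by []. Qed.

(** The value [a0] at a vanishing gradient makes the bounds on the step sizes
    hold for every [k]. *)
Definition step k : R :=
  if g k.+1 == 0 then a0 else
  Num.min (BB_stepsize b (x k.+1 - x k) (g k.+1 - g k)) (Delta / enorm (g k.+1)).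

Lemma BBstab_step k : x k.+2 = x k.+1 - step k *: g k.+1.
Proof.
rewrite BBstabE /BBstab_next /step -/(g k.+1).
by case: eqP => [->|//]; rewrite scaler0 subr0.
Qed.

Lemma step_bounds k : (x k = x k.+1 -> g k.+1 = 0) ->
  [/\ a0 <= step k \/ step k = Delta / enorm (g k.+1) /\ g k.+1 != 0,
      step k * dot (x k.+1 - x k) (g k.+1 - g k) <=
        dot (x k.+1 - x k) (x k.+1 - x k) &
      step k * enorm (g k.+1) <= Delta].
Proof.
move=> stuck; rewrite /step; case: eqP => [g0|/eqP g0].
  split; first by left.
    apply: le_trans (_ : a0 * (l * enorm (x k.+1 - x k) ^+ 2) <= _).
      by rewrite ler_pM2l //; exact: dot_diff_le.
    by rewrite mulrA sqr_enorm ler_piMl // dot_ge0.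
  by rewrite g0 enorm0 mulr0 ltW.
have xx : x k.+1 != x k by apply: contra_neq g0 => /esym.
have [lo hi] := BB_stepsize_bounds xx.
have gp : 0 < enorm (g k.+1) by rewrite enorm_gt0.
have sy : 0 <= dot (x k.+1 - x k) (g k.+1 - g k).
  rewrite dotC; apply: le_trans (mono _ _).
  by rewrite mulr_ge0 ?exprn_ge0 ?enorm_ge0 // ltW.
split.
- by rewrite /Num.min; case: ifP => _; [left|right].
- apply: le_trans hi; rewrite ler_wpM2r // ge_min lexx //.
- by rewrite -ler_pdivlMr // ge_min lexx orbT.
Qed.

Lemma step_gt0 k : (x k = x k.+1 -> g k.+1 = 0) -> 0 < step k.
Proof.
case/step_bounds => -[h|[-> g0]] _ _; first exact: lt_le_trans h.
by rewrite divr_gt0 // enorm_gt0.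
Qed.

(** The step sizes are positive, so the iterates can only stall at a critical
    point; elsewhere the Barzilai-Borwein quotients are well defined. *)
Lemma BBstab_stuck k : x k = x k.+1 -> g k.+1 = 0.
Proof.
elim: k => [e01|k IH exx]; first by move: x0x1; rewrite -[x0]/(x 0) -[x1]/(x 1) e01 eqxx.
suff g0 : g k.+1 = 0 by rewrite /g -exx.
move/eqP: exx; rewrite BBstab_step -subr_eq0 opprB addrC subrK scaler_eq0.
by rewrite gt_eqF ?step_gt0 //= => /eqP.
Qed.

Let stepP k := step_bounds (@BBstab_stuck k).
Let step_pos k := step_gt0 (@BBstab_stuck k).

Variable xs : 'rV[R]_n.
Hypothesis gxs : grad f xs = 0.

Lemma grad_norm_le y : enorm (grad f y) <= l * enorm (y - xs).
Proof. by have := lip y xs; rewrite gxs subr0. Qed.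

Lemma grad_norm_ge y : mu * enorm (y - xs) <= enorm (grad f y).
Proof.
have [->|y0] := eqVneq y xs; first by rewrite subrr enorm0 mulr0 enorm_ge0.
have p : 0 < enorm (y - xs) by rewrite enorm_gt0 subr_eq0.
rewrite -(ler_pM2r p) -mulrA -expr2.
apply: le_trans (dot_le_enorm _ _).
by have := mono y xs; rewrite gxs subr0.
Qed.

(** For steps up to [mu / l ^+ 2] the second-order term of the squared distance
    is at most half of the first-order one. *)
Lemma short_step_contraction y t : 0 <= t -> t <= a0 ->
  enorm (y - t *: grad f y - xs) ^+ 2 <= (1 - t * mu) * enorm (y - xs) ^+ 2.
Proof.
move=> t0 ta.
have -> : y - t *: grad f y - xs = (y - xs) + - (t *: grad f y).
  by rewrite addrAC.
rewrite sqr_enormD dotNr dotZr enormN enormZ ger0_norm // exprMn.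
have hm : mu * enorm (y - xs) ^+ 2 <= dot (y - xs) (grad f y).
  by have := mono y xs; rewrite gxs subr0 dotC.
have hg : enorm (grad f y) ^+ 2 <= l ^+ 2 * enorm (y - xs) ^+ 2.
  rewrite -exprMn ler_pXn2r ?nnegrE ?mulr_ge0 ?enorm_ge0 ?(ltW l_gt0) //.
  exact: grad_norm_le.
have h1 := ler_wpM2l t0 hm.
have h2 : t ^+ 2 * enorm (grad f y) ^+ 2 <= t * (mu * enorm (y - xs) ^+ 2).
  apply: le_trans (_ : t ^+ 2 * (l ^+ 2 * enorm (y - xs) ^+ 2) <= _).
    by rewrite ler_wpM2l // exprn_ge0.
  rewrite expr2 -mulrA ler_wpM2l // mulrA ler_wpM2r ?exprn_ge0 ?enorm_ge0 //.
  by rewrite -ler_pdivlMr // exprn_gt0.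
lra.
Qed.

(* Where the gradient is below the threshold [Delta / a0], the distance to [xs]
   is at most [l ^+ 2 / mu ^+ 2 * Delta], and one step adds at most [Delta]. *)
Let rad := (l ^+ 2 / mu ^+ 2 + 1) * Delta.

(** Above the threshold [Delta / a0] the stabilizing step [Delta / enorm g] is
    below [a0], hence it is the one taken and it is short. *)
Lemma far_decrease k : Delta / a0 <= enorm (g k.+1) ->
  enorm (x k.+2 - xs) ^+ 2 <= enorm (x k.+1 - xs) ^+ 2 - Delta ^+ 2.
Proof.
move=> far; have gp : 0 < enorm (g k.+1).
  by apply: lt_le_trans far; exact: divr_gt0.
have [lo _ hi] := stepP k.
have s0 := ltW (step_pos k).
have da : Delta <= a0 * enorm (g k.+1) by rewrite mulrC -ler_pdivrMr.
have sa : step k <= a0.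
  by rewrite -(ler_pM2r gp); exact: le_trans hi da.
have sg : Delta <= step k * enorm (g k.+1).
  case: lo => [h|[-> _]]; last by rewrite divfK // gt_eqF.
  by apply: le_trans da _; rewrite ler_pM2r.
rewrite BBstab_step; apply: le_trans (short_step_contraction _ s0 sa) _.
set E := enorm (x k.+1 - xs).
have gE : enorm (g k.+1) <= l * E by exact: grad_norm_le.
have h1 : Delta <= step k * (l * E) by apply: le_trans sg _; exact: ler_wpM2l.
have h2 : Delta * l <= mu * E.
  have : Delta <= a0 * (l * E) by apply: le_trans da _; rewrite ler_pM2l.
  have -> : a0 * (l * E) = mu * E / l by rewrite /a0; field; rewrite gt_eqF.
  by rewrite ler_pdivlMr.
have h3 : Delta * (Delta * l) <= step k * (l * E) * (mu * E).
  by apply: ler_pM => //; rewrite ?mulr_ge0 ?(ltW Delta_gt0) ?(ltW l_gt0).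
have h4 : Delta ^+ 2 <= step k * mu * E ^+ 2.
  rewrite -(ler_pM2r l_gt0); lra.
lra.
Qed.

Lemma near_radius k : enorm (g k.+1) < Delta / a0 ->
  enorm (x k.+1 - xs) <= l ^+ 2 / mu ^+ 2 * Delta.
Proof.
move=> near; rewrite -(ler_pM2l mu_gt0).
apply: le_trans (grad_norm_ge _) _; apply: le_trans (ltW near) _.
rewrite le_eqVlt; apply/orP; left; apply/eqP.
by rewrite /a0; field; rewrite !gt_eqF.
Qed.

Lemma rad_invariant k :
  enorm (x k.+1 - xs) <= rad -> enorm (x k.+2 - xs) <= rad.
Proof.
move=> hk; have [far|near] := leP (Delta / a0) (enorm (g k.+1)).
  apply: le_trans hk.
  rewrite -(@ler_pXn2r _ 2) ?nnegrE ?enorm_ge0 //.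
  by apply: le_trans (far_decrease far) _; rewrite gerBl sqr_ge0.
rewrite BBstab_step addrAC; apply: le_trans (ler_enormB _ _) _.
rewrite /rad mulrDl mul1r; apply: lerD; first exact: near_radius.
have [_ _] := stepP k; rewrite enormZ ger0_norm //.
exact: ltW (step_pos k).
Qed.

Lemma eventually_within_rad :
  exists k0, forall k, (k0 <= k)%N -> enorm (x k.+1 - xs) <= rad.
Proof.
suff [k0 hk0] : exists k0, enorm (x k0.+1 - xs) <= rad.
  exists k0 => k; elim: k => [|k IH]; first by rewrite leqn0 => /eqP k00; move: hk0; rewrite k00.
  rewrite leq_eqVlt => /predU1P[<- //|]; rewrite ltnS => /IH.
  exact: rad_invariant.
apply: contrapT => /forallNP none.
have dec k : enorm (x k.+1 - xs) ^+ 2 <=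
    enorm (x 1%N - xs) ^+ 2 - k%:R * Delta ^+ 2.
  elim: k => [|k IH]; first by rewrite mul0r subr0.
  have [far|near] := leP (Delta / a0) (enorm (g k.+1)).
    by have := far_decrease far; rewrite -natr1; lra.
  case: (none k); apply: le_trans (near_radius near) _.
  by rewrite /rad mulrDl mul1r lerDl ltW.
have D2 : 0 < Delta ^+ 2 by exact: exprn_gt0.
pose k := (Num.truncn (enorm (x 1%N - xs) ^+ 2 / Delta ^+ 2)).+1.
have : enorm (x 1%N - xs) ^+ 2 < k%:R * Delta ^+ 2.
  by rewrite -ltr_pdivrMr // truncnS_gt.
have := dec k; have := exprn_ge0 2 (enorm_ge0 (x k.+1 - xs)); lra.
Qed.

Lemma step_le k : step k <= mu^-1.
Proof.
have l2 : a0 <= mu^-1.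
  rewrite /a0 ler_pdivrMr ?exprn_gt0 // ler_pdivlMl // -expr2.
  by rewrite ler_pXn2r // nnegrE ltW.
have [g0|g0] := eqVneq (g k.+1) 0; first by rewrite /step g0 eqxx.
have xx : x k != x k.+1 by apply: contra_neq g0; exact: BBstab_stuck.
have [_ hi _] := stepP k.
have hm : mu * dot (x k.+1 - x k) (x k.+1 - x k) <=
    dot (x k.+1 - x k) (g k.+1 - g k).
  by rewrite [leRHS]dotC -sqr_enorm; exact: mono.
have s0 : 0 < dot (x k.+1 - x k) (x k.+1 - x k).
  by rewrite lt_def dot_ge0 andbT dot_eq0 subr_eq0 eq_sym.
have := le_trans (ler_wpM2l (ltW (step_pos k)) hm) hi.
by rewrite mulrA -ler_pdivlMr // divff ?gt_eqF // -ler_pdivlMr // div1r.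
Qed.

Lemma BBstab_growth k :
  enorm (x k.+2 - xs) <= (1 + l / mu) * enorm (x k.+1 - xs).
Proof.
rewrite BBstab_step addrAC.
apply: le_trans (ler_enormB _ _) _; rewrite mulrDl mul1r lerD2l enormZ.
rewrite [l / mu]mulrC -mulrA; apply: ler_pM; rewrite ?enorm_ge0 //.
  by rewrite ger0_norm; [exact: step_le | exact: ltW (step_pos k)].
exact: grad_norm_le.
Qed.

Definition min_step := Num.min a0 (l * (l ^+ 2 / mu ^+ 2 + 1))^-1.

Lemma min_step_gt0 : 0 < min_step.
Proof. by rewrite lt_min a0_gt0 invr_gt0 mulr_gt0 // addr_gt0 // divr_gt0 // exprn_gt0. Qed.

(** Once the iterates stay within [rad], of order [Delta], the stabilizing bound
    [Delta / enorm (g k)] is bounded below independently of [Delta]. *)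
Lemma gradient_run_BBstab (H : 'M[R]_n) k0 :
  (forall k, (k0 <= k)%N -> enorm (x k.+1 - xs) <= rad) ->
  (forall y z, enorm (y - xs) <= rad -> enorm (z - xs) <= rad ->
     enorm (grad f y - grad f z - (y - z) *m H) <= mu / 12 * enorm (y - z)) ->
  gradient_run H mu min_step mu^-1 (fun j => x (k0 + j).+1 - xs)
    (fun j => g (k0 + j).+1) (fun j => step (k0 + j)).
Proof.
move=> within affine; split=> k.
- by rewrite addnS BBstab_step addrAC.
- rewrite step_le andbT.
  have [[h _ _|[-> g0] _ _]] := stepP (k0 + k); first by rewrite ge_min h.
  rewrite ge_min; apply/orP; right.
  have gp : 0 < enorm (g (k0 + k).+1) by rewrite enorm_gt0.
  have c0 : 0 < l * (l ^+ 2 / mu ^+ 2 + 1).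
    by rewrite mulr_gt0 // addr_gt0 // divr_gt0 // exprn_gt0.
  rewrite ler_pdivlMr // ler_pdivrMl //.
  apply: le_trans (grad_norm_le _) _; rewrite -mulrA ler_pM2l //.
  by apply: within; rewrite leq_addr.
rewrite addnS; set i := (k0 + k)%N.
have [_ hi _] := stepP i.+1.
have [<-|g0] := eqVneq 0 (g i.+1); first by rewrite mul0mx !dot0l mulr0 subr0 mulr0.
have t0 := step_pos i.
have st0 := ltW (step_pos i.+1).
have hs : x i.+2 - x i.+1 = - step i *: g i.+1.
  by rewrite BBstab_step addrAC subrr add0r scaleNr.
set s := x i.+2 - x i.+1 in hi hs.
have key : dot (s *m H) s - mu / 12 * dot s s <= dot s (g i.+2 - g i.+1).
  set y := g i.+2 - g i.+1; set r := y - s *m H.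
  have ry : enorm r <= mu / 12 * enorm s.
    by apply: affine; apply: within; rewrite ?leq_addr // (leq_trans (leq_addr k k0)).
  have -> : dot s y = dot (s *m H) s + dot s r.
    by rewrite (dotC _ s) -dotDr /r addrC subrK.
  rewrite lerD2l.
  have := le_trans (normr_dot_le s r) (ler_wpM2l (enorm_ge0 s) ry).
  rewrite mulrCA -expr2 sqr_enorm ler_norml => /andP[+ _]; exact.
have {key hi} := le_trans (ler_wpM2l st0 key) hi.
rewrite hs -scalemxAl !dotZl !dotZr => h.
have t2 : 0 < step i ^+ 2 by exact: exprn_gt0.
rewrite -(ler_pM2l t2); lra.
Qed.

End Iteration.

(** * From contraction over blocks to an R-linear rate *)

Lemma bernoulli_le (R : realType) (t : R) (m : nat) :
  0 <= t -> t <= 1 -> 1 - m%:R * t <= (1 - t) ^+ m.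
Proof.
move=> t0 t1; elim: m => [|m IH]; first by rewrite mul0r subr0 expr0.
have t1' : 0 <= 1 - t by rewrite subr_ge0.
rewrite exprS -natr1; have := ler_wpM2l t1' IH.
have : 0 <= m%:R * t * t by rewrite !mulr_ge0 // ler0n.
lra.
Qed.

(** The growth bound [D] controls the iterates inside a block and before time
    [k0]; the halving of every block of [m] steps gives the rate. *)
Lemma geometric_of_block_halving (R : realType) (v : nat -> R) (D : R)
    (m k0 : nat) : (0 < m)%N -> 1 <= D ->
  (forall k, 0 <= v k) -> (forall k, v k.+1 <= D * v k) ->
  (forall k, (k0 <= k)%N -> v (k + m)%N <= 1 / 2 * v k) ->
  exists gamma c : R, [/\ 0 < gamma, 0 < c < 1 &
    forall k, v k <= gamma * c ^+ k * v 0%N].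
Proof.
move=> m0 D1 v0 grow halve.
have D0 : 0 < D by exact: lt_le_trans D1.
have m0R : 0 < m%:R :> R by rewrite ltr0n.
(* This [c] satisfies [c ^+ m >= 1 / 2] by Bernoulli's inequality. *)
pose t : R := (2 * m%:R)^-1.
have mt : m%:R * t = 1 / 2 by rewrite /t; field; rewrite gt_eqF.
have t0 : 0 < t by rewrite invr_gt0 mulr_gt0.
have t1 : t <= 1 / 2.
  by rewrite -mt ler_peMl ?(ltW t0) // ler1n.
pose c := 1 - t.
have c01 : 0 < c < 1 by rewrite /c; apply/andP; split; lra.
have /andP[c0 c1] := c01.
have cm : 1 / 2 <= c ^+ m.
  by apply: le_trans (bernoulli_le m (ltW t0) _); lra.
have Dc1 : 1 <= D / c by rewrite ler_pdivlMr // mul1r (le_trans _ D1) // ltW.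
pose gamma := (D / c) ^+ (k0 + m).
have gamma0 : 0 < gamma by rewrite exprn_gt0 // divr_gt0.
exists gamma, c; split=> //.
(* The factor [gamma] covers the steps before the first complete block, during
   which only the growth bound [D] is available. *)
have growth k : v k <= D ^+ k * v 0%N.
  elim: k => [|k IH]; first by rewrite expr0 mul1r.
  by apply: le_trans (grow k) _; rewrite exprS -mulrA ler_pM2l.
elim/ltn_ind => k IH.
have [hk|hk] := ltnP k (k0 + m).
  apply: le_trans (growth k) _; rewrite ler_wpM2r //.
  have -> : D ^+ k = (D / c) ^+ k * c ^+ k.
    by rewrite -exprMn divfK // gt_eqF.
  by rewrite ler_pM2r ?exprn_gt0 // ler_weXn2l // ltnW.
have mk : (m <= k)%N by rewrite (leq_trans _ hk) // leq_addl.
have := halve (k - m)%N; rewrite subnK // leq_subRL // addnC => /(_ hk).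
move=> /le_trans; apply.
have km : (k - m < k)%N by rewrite ltn_subrL m0 (leq_trans m0).
apply: le_trans (ler_wpM2l _ (IH _ km)) _; first by rewrite divr_ge0.
rewrite -[in X in _ <= X](subnK mk) exprD.
have h : 0 <= gamma * c ^+ (k - m) * v 0%N.
  by rewrite mulr_ge0 ?v0 // mulr_ge0 ?(ltW gamma0) ?exprn_ge0 ?(ltW c0).
have := ler_wpM2r h cm; lra.
Qed.

(** The topology of ['rV_n] is that of the max norm, which the Euclidean norm
    dominates. *)
Lemma cvg_of_geometric (R : realType) (n : nat) (x : nat -> 'rV[R]_n)
    (xs : 'rV[R]_n) (M c : R) : 0 < c < 1 ->
  (forall k, enorm (x k.+1 - xs) <= M * c ^+ k) -> x @ \oo --> xs.
Proof.
move=> /andP[c0 c1] hx; apply/cvgrPdist_le => e e0.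
have M1 : 0 < `|M| + 1 by rewrite ltr_wpDl.
have [j hj] := ltr_expr_small (ltW c0) c1 (divr_gt0 e0 M1).
exists j.+1 => // -[//|k] /= hk.
have le_e : enorm (x k.+1 - xs) <= e.
  apply: le_trans (hx k) _.
  apply: le_trans (_ : (`|M| + 1) * c ^+ k <= _).
    rewrite ler_wpM2r ?exprn_ge0 ?(ltW c0) //.
    by rewrite (le_trans (ler_norm M)) // lerDl.
  rewrite mulrC -ler_pdivlMr //; apply: le_trans hj.
  by apply: ler_wiXn2l; rewrite ?(ltW c0) ?(ltW c1) // -ltnS.
rewrite distrC [leLHS]mx_normrE; apply: bigmax_le; first exact: ltW.
by case=> i i' _; rewrite (ord1 i); exact: le_trans (normr_coord_le _ _) le_e.
Qed.

(** * Convergence of the stabilized Barzilai-Borwein method *)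

Theorem theorem3p3 (R : realType) (n : nat) (f : 'rV[R]_n -> R)
    (xs : 'rV[R]_n) (b : BB_choice) :
  assumption_A1 f -> minimizer f xs -> assumption_A2 f xs ->
  exists Delta_bar : R, 0 < Delta_bar /\
    forall Delta : R, 0 < Delta <= Delta_bar ->
    forall x0 x1 : 'rV[R]_n, x0 <> x1 ->
      (BBstab b f Delta x0 x1 @ \oo --> xs) /\
      R_linear_rate (BBstab b f Delta x0 x1) xs.
Proof.
move=> [C2 [mu [l [mu0 mul hess_bounds]]]] xs_min [rho [L [rho0 L0 hessL]]].
have l0 : 0 < l by exact: lt_le_trans mul.
have gxs : grad f xs = 0.
  exact: minimizer_grad_eq0 C2 mu0 hess_bounds _ l0 xs_min.
have mono := grad_strongly_monotone C2 hess_bounds.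
have lip x y := grad_lipschitz C2 mu0 hess_bounds x y (ltW l0).
have symH : (hess f xs)^T = hess f xs by exact: hess_sym.
have [lam [p [eig pars]]] := symmetric_eigenframe symH.
have muV : 0 < mu^-1 by rewrite invr_gt0.
have [m [delta [m0 delta0 contract]]] := local_contraction symH mu0
  (hess_bounds xs) eig pars mul (min_step_gt0 mu0 mul) muV.
pose C := l ^+ 2 / mu ^+ 2 + 1.
have C0 : 0 < C by rewrite addr_gt0 // divr_gt0 // exprn_gt0.
pose d := Num.min delta (mu / 12).
have d0 : 0 < d by rewrite lt_min delta0 divr_gt0.
have LC : 0 < L * C + 1 by rewrite ltr_wpDl // mulr_ge0 // ltW.
(* The ball of radius [C * Delta] must lie in the one of radius [rho], and the
   relative error [L * (C * Delta)] must be at most [d]. *)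
exists (Num.min (rho / C) (d / (L * C + 1))).
split=> [|Delta]; first by rewrite lt_min !divr_gt0.
rewrite le_min => /and3P[Delta0 Delta_rho Delta_d] x0 x1 /eqP x01.
have rad_rho : C * Delta <= rho by rewrite mulrC -ler_pdivlMr.
have rad_d : L * (C * Delta) <= d.
  by move: Delta_d; rewrite ler_pdivlMr //; lra.
have dg z : differentiable (grad f) z by case: C2.
have affine y z : enorm (y - xs) <= C * Delta -> enorm (z - xs) <= C * Delta ->
    enorm (grad f y - grad f z - (y - z) *m hess f xs) <= d * enorm (y - z).
  move=> hy hz; apply: le_trans (grad_near_affine dg L0 _ hy hz) _.
    by move=> x hx; apply: hessL; exact: le_trans rad_rho.
  by rewrite ler_wpM2r // enorm_ge0.
set x := BBstab b f Delta x0 x1.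
have [k0 within] := eventually_within_rad b mu0 mul mono lip Delta0 x01 gxs.
have halve k : (k0 <= k)%N ->
    enorm (x (k + m).+1 - xs) <= 1 / 2 * enorm (x k.+1 - xs).
  move=> hk.
  have within_k j : (k <= j)%N -> enorm (x j.+1 - xs) <= C * Delta.
    by move=> kj; apply: within; exact: leq_trans kj.
  have affine' y z : enorm (y - xs) <= C * Delta ->
      enorm (z - xs) <= C * Delta ->
      enorm (grad f y - grad f z - (y - z) *m hess f xs) <=
      mu / 12 * enorm (y - z).
    move=> hy hz; apply: le_trans (affine _ _ hy hz) _.
    by rewrite ler_wpM2r ?enorm_ge0 // ge_min lexx orbT.
  have run := gradient_run_BBstab mu0 mul mono lip Delta0 x01 gxs
    within_k affine'.
  have := contract _ _ _ run; rewrite addn0; apply=> j.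
  have := affine (x (k + j).+1) xs (within_k _ (leq_addr j k)).
  rewrite subrr enorm0 gxs subr0 => /(_ _) h; apply: le_trans (h _) _.
    by rewrite mulr_ge0 // ltW.
  by rewrite ler_wpM2r ?enorm_ge0 // ge_min lexx.
have grow k : enorm (x k.+2 - xs) <= (1 + l / mu) * enorm (x k.+1 - xs).
  exact: (BBstab_growth b mu0 mul mono lip Delta0 x01 gxs).
have D1 : 1 <= 1 + l / mu by rewrite lerDl divr_ge0 // ltW.
have [gamma [c [gamma0 c01 rate]]] := geometric_of_block_halving m0 D1
  (fun k => enorm_ge0 (x k.+1 - xs)) grow halve.
split; last by exists gamma, c; split=> // k _; exact: rate.
apply: (@cvg_of_geometric _ _ _ _ (gamma * enorm (x 1%N - xs)) c) => // k.
by rewrite mulrAC; exact: rate.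
Qed.
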